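(* Let $(G_\alpha)_{\alpha\in I}$ be a family of topological Abelian groups in $S_{TG}(\mathbb{T})$. Then the coproduct $\bigoplus_{\alpha\in I}G_\alpha$ belongs to $S_{TG}(\mathbb{T})$.
   Context: The coproduct of a family $(G_\alpha)_{\alpha\in I}$ of topological Abelian groups is the direct sum $\bigoplus_{\alpha\in I}G_\alpha$ endowed with the finest group topology making the inclusion maps $i_\beta:G_\beta\hookrightarrow\bigoplus_{\alpha\in I}G_\alpha$ continuous for every $\beta\in I$. $\mathbb{T}$ denotes the unit circle of $\mathbb{C}$ with its usual topology and multiplication. A twisted sum of topological Abelian groups is a short exact sequence $0\to Y\stackrel{\imath}{\to} X\stackrel{\pi}{\to} Z\to 0$ of topological Abelian groups and continuous homomorphisms in which $\imath$ and $\pi$ are open onto their images. It splits if there is a continuous homomorphism $\Phi:X\to Y\times Z$ such that $\Phi\circ\imath$ is the canonical inclusion $y\mapsto (y,0)$ and $\pi_Z\circ\Phi=\pi$, where $\pi_Z:Y\times Z\to Z$ is the projection (such $\Phi$ is necessarily a topological isomorphism). A topological Abelian group $G$ belongs to $S_{TG}(\mathbb{T})$ if every twisted sum of topological Abelian groups $0\to\mathbb{T}\to X\to G\to 0$ splits. *)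

(* Defs.v *)
From HB Require Import structures.
From mathcomp Require Import all_boot all_order all_algebra finmap.
From mathcomp Require Import all_classical all_reals all_analysis.
From mathcomp Require Import complex.

Set Implicit Arguments.
Unset Strict Implicit.
Unset Printing Implicit Defensive.

Import Order.TTheory GRing.Theory Num.Theory.
Import numFieldNormedType.Exports.

Local Open Scope classical_set_scope.
Local Open Scope ring_scope.

(* The unit circle, with the topology induced by C; since `topologicalZmodType`
   is additive, `+`, `-` and `0` on `circle R` are the multiplication, the
   inverse and the unit of complex numbers. *)
Record circle (R : realType) :=
  Circle { circle_val : R[i]; _ : `|circle_val| == 1 }.

Section Circle.
Variable R : realType.

HB.instance Definition _ := [isSub for @circle_val R].
HB.instance Definition _ := [Choice of circle R by <:].

Local Notation cval := (@circle_val R).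

Lemma circle_normE (z : circle R) : `|cval z| = 1.
Proof. by case: z => z /= /eqP. Qed.

Lemma circle_neq0 (z : circle R) : cval z != 0.
Proof. by rewrite -normr_eq0 circle_normE oner_eq0. Qed.

Fact circle_one_subproof : `|1 : R[i]| == 1.
Proof. by rewrite normr1. Qed.

Fact circle_mul_subproof (z w : circle R) : `|cval z * cval w| == 1.
Proof. by rewrite normrM !circle_normE mulr1. Qed.

Fact circle_inv_subproof (z : circle R) : `|(cval z)^-1| == 1.
Proof. by rewrite normfV circle_normE invr1. Qed.

Definition circle_one := Circle circle_one_subproof.
Definition circle_mul z w := Circle (circle_mul_subproof z w).
Definition circle_inv z := Circle (circle_inv_subproof z).

Fact circle_mulA : associative circle_mul.
Proof. by move=> x y z; apply: val_inj; rewrite /= mulrA. Qed.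

Fact circle_mulC : commutative circle_mul.
Proof. by move=> x y; apply: val_inj; rewrite /= mulrC. Qed.

Fact circle_mul1 : left_id circle_one circle_mul.
Proof. by move=> x; apply: val_inj; rewrite /= mul1r. Qed.

Fact circle_mulV : left_inverse circle_one circle_inv circle_mul.
Proof. by move=> x; apply: val_inj; rewrite /= mulVf// circle_neq0. Qed.

HB.instance Definition _ := GRing.isZmodule.Build (circle R)
  circle_mulA circle_mulC circle_mul1 circle_mulV.

HB.instance Definition _ := Topological.copy (circle R)
  (initial_topology (cval : circle R -> (R[i])^o)).

Lemma circle_val_continuous : continuous (cval : circle R -> (R[i])^o).
Proof. exact: initial_continuous. Qed.

Lemma continuous_to_circle (T : topologicalType) (f : T -> circle R) :
  continuous (cval \o f : T -> (R[i])^o) -> continuous f.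
Proof.
move=> cf; apply/continuousP => _ [B oB <-].
by move/continuousP : cf => /(_ B oB).
Qed.

Fact circle_add_continuous : continuous (fun x : circle R * circle R => x.1 + x.2).
Proof.
apply: continuous_to_circle => x.
apply: (@cvgM (R[i]) _ (nbhs x) _ (cval \o fst) (cval \o snd)).
- by apply: continuous_comp; [exact: cvg_fst|exact: circle_val_continuous].
- by apply: continuous_comp; [exact: cvg_snd|exact: circle_val_continuous].
Qed.

Fact circle_opp_continuous : continuous (-%R : circle R -> circle R).
Proof.
apply: continuous_to_circle => x.
apply: (@cvgV (R[i]) _ (nbhs x) _ cval); first exact: circle_neq0.
exact: circle_val_continuous.
Qed.

HB.instance Definition _ :=
  PreTopologicalNmodule_isTopologicalNmodule.Build (circle R)
    circle_add_continuous.
HB.instance Definition _ :=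
  TopologicalNmodule_isTopologicalZmodule.Build (circle R)
    circle_opp_continuous.

End Circle.

Definition open_onto_image (X Y : topologicalType) (f : X -> Y) :=
  forall U, open U -> exists2 V, open V & f @` U = V `&` range f.

Record twisted_sum (Y X Z : topologicalZmodType)
    (i : {additive Y -> X}) (p : {additive X -> Z}) : Prop := TwistedSum {
  twisted_sum_inj : injective i;
  twisted_sum_exact : range i = p @^-1` [set 0];
  twisted_sum_surj : range p = setT;
  twisted_sum_inj_continuous : continuous i;
  twisted_sum_proj_continuous : continuous p;
  twisted_sum_inj_open : open_onto_image i;
  twisted_sum_proj_open : open_onto_image p
}.

Definition splits (Y X Z : topologicalZmodType)
    (i : {additive Y -> X}) (p : {additive X -> Z}) : Prop :=
  exists Phi : {additive X -> (Y * Z)%type},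
    [/\ continuous Phi, forall y, Phi (i y) = (y, 0)
      & forall x, (Phi x).2 = p x].

Definition STG (Y G : topologicalZmodType) : Prop :=
  forall (X : topologicalZmodType) (i : {additive Y -> X})
    (p : {additive X -> G}), twisted_sum i p -> splits i p.

Record dirsum (I : Type) (G : I -> zmodType) := DirSum {
  dirsum_val :> forall a, G a;
  _ : `[< finite_set [set a | dirsum_val a <> 0] >] }.

Section DirSumZmodule.
Variables (I : Type) (G : I -> zmodType).
Local Notation S := (dirsum G).

Lemma dirsum_finite (f : S) : finite_set [set a | f a <> 0].
Proof. by case: f => f /= /asboolP. Qed.

Lemma dirsumP (f g : S) : (forall a, f a = g a) -> f = g.
Proof.
case: f g => [f fP] [g gP] /= fg.
have {}fg : f = g by apply: functional_extensionality_dep.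
by case: _ / fg gP => gP; congr DirSum; exact: Prop_irrelevance.
Qed.

HB.instance Definition _ := gen_eqMixin S.
HB.instance Definition _ := gen_choiceMixin S.

Fact dirsum_zero_subproof : `[< finite_set [set a | (0 : G a) <> 0] >].
Proof.
by apply/asboolP; apply: (sub_finite_set (B := set0)) => // a /=; apply.
Qed.

Fact dirsum_add_subproof (f g : S) :
  `[< finite_set [set a | f a + g a <> 0] >].
Proof.
apply/asboolP; apply: (@sub_finite_set _ _ ([set a | f a <> 0] `|` [set a | g a <> 0])).
  move=> a /= fga; have [fa|] := pselect (f a = 0); last by left.
  by right => ga; apply: fga; rewrite fa ga addr0.
by rewrite finite_setU; split; exact: dirsum_finite.
Qed.

Fact dirsum_opp_subproof (f : S) : `[< finite_set [set a | - f a <> 0] >].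
Proof.
apply/asboolP; apply: sub_finite_set (dirsum_finite f) => a /= fa f0.
by apply: fa; rewrite f0 oppr0.
Qed.

Definition dirsum_zero : S := DirSum dirsum_zero_subproof.
Definition dirsum_add (f g : S) : S := DirSum (dirsum_add_subproof f g).
Definition dirsum_opp (f : S) : S := DirSum (dirsum_opp_subproof f).

Fact dirsum_addA : associative dirsum_add.
Proof. by move=> f g h; apply: dirsumP => a /=; rewrite addrA. Qed.

Fact dirsum_addC : commutative dirsum_add.
Proof. by move=> f g; apply: dirsumP => a /=; rewrite addrC. Qed.

Fact dirsum_add0 : left_id dirsum_zero dirsum_add.
Proof. by move=> f; apply: dirsumP => a /=; rewrite add0r. Qed.

Fact dirsum_addN : left_inverse dirsum_zero dirsum_opp dirsum_add.
Proof. by move=> f; apply: dirsumP => a /=; rewrite addNr. Qed.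

HB.instance Definition _ := GRing.isZmodule.Build S
  dirsum_addA dirsum_addC dirsum_add0 dirsum_addN.

Fact dirsum_in_subproof (b : I) (x : G b) :
  `[< finite_set [set a | @dfwith {classic I} G (fun=> 0) b x a <> 0] >].
Proof.
apply/asboolP; apply: (@sub_finite_set _ _ [set b]) => // a /=.
apply: contra_notP => ab; rewrite (@dfwithout {classic I})//.
by apply/eqP => ba; apply: ab.
Qed.

Definition dirsum_in (b : I) (x : G b) : S := DirSum (dirsum_in_subproof x).

End DirSumZmodule.

Definition coproduct (I : Type) (G : I -> topologicalZmodType) : Type :=
  dirsum G.

Section Coproduct.
Variables (I : Type) (G : I -> topologicalZmodType).
Local Notation S := (coproduct G).

HB.instance Definition _ := GRing.Zmodule.on S.

Definition coproduct_in (b : I) (x : G b) : S := dirsum_in x.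

(* `t` is a topology on the direct sum, packed as the class of a
   topologicalType structure. *)
Record admissible (t : Topological S) : Prop := Admissible {
  admissible_add :
    let T := Topological.Pack t in
    continuous ((fun x => x.1 + x.2 :> S) : T * T -> T);
  admissible_opp :
    let T := Topological.Pack t in continuous ((fun x => - x :> S) : T -> T);
  admissible_in : forall b,
    let T := Topological.Pack t in continuous (@coproduct_in b : G b -> T)
}.

Definition coproduct_subbase : set_system S :=
  [set U : set S | exists2 t : Topological S, admissible t & @open (Topological.Pack t) U].

(* The supremum of all the admissible topologies; `sup_topology` does not apply
   because the type of all topologies on S is too large to index the family.
   By `coproduct_admissible` and `coproduct_finest` it is the finest admissible
   topology. *)
HB.instance Definition _ := isSubBaseTopological.Build S coproduct_subbase id.

Lemma coproduct_open (t : Topological S) (U : set S) :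
  admissible t -> @open (Topological.Pack t) U -> @open S U.
Proof.
move=> tadm oU; exists [set U]; last by rewrite bigcup_set1.
move=> _ ->; exists [fset U]%fset; last by rewrite set_fset1 bigcap_set1.
by move=> V /fset1P ->; apply/mem_set; exists t.
Qed.

Lemma coproduct_cvg (F : set_system S) (x : S) : Filter F ->
  (forall t : Topological S, admissible t -> F --> (x : Topological.Pack t)) ->
  F --> x.
Proof.
move=> FF cvF A; rewrite nbhsE => -[_ [[B sB <-] [C BC Cx] BA]].
apply: filterS BA _; apply: (@filterS _ _ _ C); first by move=> y Cy; exists C.
have [D sD DC] := sB _ BC; rewrite -DC; apply: filter_bigI => E DE.
have /set_mem [t tadm oE] := sD _ DE; apply: (cvF t tadm).
apply: open_nbhs_nbhs; split => //.
by move: Cx; rewrite -DC => /(_ E); apply.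
Qed.

Lemma coproduct_id_continuous (t : Topological S) : admissible t ->
  continuous (id : S -> Topological.Pack t).
Proof.
by move=> tadm; apply/continuousP => A oA; exact: coproduct_open oA.
Qed.

Fact coproduct_add_continuous : continuous (fun x : S * S => x.1 + x.2).
Proof.
move=> x; apply: coproduct_cvg => t tadm.
pose T := Topological.Pack t.
apply: (@continuous_comp (S * S)%type (T * T)%type T
  (fun y => (y.1, y.2)) (fun y => y.1 + y.2 :> S)); last first.
  exact: admissible_add.
apply: cvg_pair => /=.
- apply: (@continuous_comp _ S T fst id); first exact: cvg_fst.
  exact: coproduct_id_continuous.
- apply: (@continuous_comp _ S T snd id); first exact: cvg_snd.
  exact: coproduct_id_continuous.
Qed.

Fact coproduct_opp_continuous : continuous (-%R : S -> S).
Proof.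
move=> x; have FF : Filter (-%R @ x) := fmap_filter _ (nbhs_filter x).
apply: coproduct_cvg => t tadm.
pose T := Topological.Pack t.
apply: (@continuous_comp S T T id (fun y => - y :> S)).
  exact: coproduct_id_continuous.
exact: admissible_opp.
Qed.

HB.instance Definition _ :=
  PreTopologicalNmodule_isTopologicalNmodule.Build S coproduct_add_continuous.
HB.instance Definition _ :=
  TopologicalNmodule_isTopologicalZmodule.Build S coproduct_opp_continuous.

Lemma coproduct_in_continuous b : continuous (@coproduct_in b : G b -> S).
Proof.
by move=> x; apply: coproduct_cvg => t tadm; exact: admissible_in.
Qed.

Lemma coproduct_admissible : admissible (Topological.class S).
Proof.
split; [exact: coproduct_add_continuous|exact: coproduct_opp_continuous|].
exact: coproduct_in_continuous.
Qed.

Lemma coproduct_finest (t : Topological S) : admissible t ->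
  @open (Topological.Pack t) `<=` @open S.
Proof. by move=> tadm U; exact: coproduct_open. Qed.

End Coproduct.

(* Main.v *)
Require Import Defs.
From HB Require Import structures.
From mathcomp Require Import all_boot all_order all_algebra.
From mathcomp Require Import all_classical all_reals all_analysis.

(** The argument works with any topological Abelian group Y in the place of the
    circle: the groups G such that each twisted sum of Y by G splits are stable
    under coproducts ([STG_coproduct]).

    A twisted sum 0 -> Y -> X -> Z -> 0 splits exactly when the quotient map
    p : X -> Z has a continuous additive section ([splits_section],
    [section_splits]). From a splitting, the section sends z to x - i(y), where
    x is any point over z and y is the Y-coordinate of x; it is continuous
    because p is open. From a section s, the Y-coordinate of x is
    i^-1(x - s(p x)); it is continuous because i is open onto its image.

    Let now Z be the coproduct of the G_a. Pulling the twisted sum back along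
    the inclusion of G_a in Z gives a twisted sum of Y by G_a
    ([pullback_twisted_sum]), which splits by hypothesis. A section of this
    pullback is the same thing as a continuous additive lift h_a : G_a -> X of
    the inclusion G_a -> Z ([STG_lift]). The lifts add up to an additive map
    h from Z to X, and p o h is the identity because it is so on every G_a
    ([coproduct_additive_eq]). Finally h is continuous because the topology
    induced by h on the direct sum is a group topology making all the
    inclusions continuous, hence is coarser than the coproduct topology
    ([coproduct_glue_continuous]). *)

Set Implicit Arguments.
Unset Strict Implicit.
Unset Printing Implicit Defensive.

Import GRing.Theory.

Local Open Scope classical_set_scope.
Local Open Scope ring_scope.

(** * Continuity of group operations *)

Section ContinuityOfOperations.
Variables (T : topologicalType) (X : topologicalZmodType).

Lemma continuous_addf (f g : T -> X) :
  continuous f -> continuous g -> continuous (fun x => f x + g x).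
Proof.
move=> cf cg x.
apply: (@continuous_comp _ _ _ (fun y => (f y, g y)) (fun z => z.1 + z.2)).
  by apply: cvg_pair; [exact: cf|exact: cg].
exact: add_continuous.
Qed.

Lemma continuous_oppf (f : T -> X) :
  continuous f -> continuous (fun x => - f x).
Proof.
by move=> cf x; apply: (continuous_comp (cf x)); exact: opp_continuous.
Qed.

End ContinuityOfOperations.

Lemma continuous_idB (X : topologicalZmodType) (f : X -> X) :
  continuous f -> continuous (fun x => x - f x).
Proof.
by move=> /continuous_oppf; apply: continuous_addf => x; exact: cvg_id.
Qed.

(** Group topologies pull back along additive maps, because the map turns the
    operations of S into those of X. *)
Section InitialGroupTopology.
Variables (S : zmodType) (X : topologicalZmodType) (phi : {additive S -> X}).
Local Notation T := (initial_topology phi).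

Lemma initial_add_continuous :
  continuous ((fun x => x.1 + x.2 :> S) : T * T -> T).
Proof.
apply: continuous_comp_initial.
rewrite [X in continuous X](_ : _ = fun x : T * T => phi x.1 + phi x.2).
  apply: continuous_addf => x; apply: continuous_comp.
  - exact: cvg_fst.
  - exact: initial_continuous.
  - exact: cvg_snd.
  - exact: initial_continuous.
by apply/funext => x /=; rewrite raddfD.
Qed.

Lemma initial_opp_continuous : continuous ((fun x => - x :> S) : T -> T).
Proof.
apply: continuous_comp_initial.
rewrite [X in continuous X](_ : _ = fun x : T => - phi x).
  by apply: continuous_oppf; exact: initial_continuous.
by apply/funext => x /=; rewrite raddfN.
Qed.

End InitialGroupTopology.

(** * Pullback of a twisted sum *)

Section Pullback.
Variables (X Z G : topologicalZmodType).
Variables (p : {additive X -> Z}) (f : {additive G -> Z}).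

Definition pullback_pred : {pred X * G} := [pred u | p u.1 == f u.2].

Fact pullback_zmod_closed : zmod_closed pullback_pred.
Proof.
split=> [|u v]; rewrite !inE /= ?raddf0// => /eqP pu /eqP pv.
by rewrite !raddfB pu pv.
Qed.

HB.instance Definition _ :=
  GRing.isZmodClosed.Build (X * G)%type pullback_pred pullback_zmod_closed.

Record pullback := Pullback {
  pullback_val : X * G; _ : pullback_val \in pullback_pred }.

HB.instance Definition _ := [isSub for pullback_val].
HB.instance Definition _ := [Choice of pullback by <:].
HB.instance Definition _ := [SubChoice_isSubZmodule of pullback by <:].

HB.instance Definition _ := Topological.copy pullback
  (initial_topology (pullback_val : pullback -> X * G)).

Definition pullback_fst (u : pullback) : X := (val u).1.
Definition pullback_snd (u : pullback) : G := (val u).2.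

Fact pullback_fst_zmod_morphism : zmod_morphism pullback_fst.
Proof. by []. Qed.

Fact pullback_snd_zmod_morphism : zmod_morphism pullback_snd.
Proof. by []. Qed.

HB.instance Definition _ := GRing.isZmodMorphism.Build pullback X
  pullback_fst pullback_fst_zmod_morphism.
HB.instance Definition _ := GRing.isZmodMorphism.Build pullback G
  pullback_snd pullback_snd_zmod_morphism.

Lemma pullbackP (u : pullback) : p (pullback_fst u) = f (pullback_snd u).
Proof. by case: u => u upf; apply/eqP. Qed.

Lemma pullback_fst_continuous : continuous pullback_fst.
Proof.
move=> x; apply: (@continuous_comp _ (X * G)%type _ pullback_val fst).
  exact: initial_continuous.
exact: cvg_fst.
Qed.

Lemma pullback_snd_continuous : continuous pullback_snd.
Proof.
move=> x; apply: (@continuous_comp _ (X * G)%type _ pullback_val snd).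
  exact: initial_continuous.
exact: cvg_snd.
Qed.

Lemma continuous_to_pullback (T : topologicalType) (g : T -> pullback) :
  continuous (pullback_fst \o g) -> continuous (pullback_snd \o g) ->
  continuous g.
Proof.
move=> c1 c2; apply: continuous_comp_initial.
have -> : pullback_val \o g = fun y => (pullback_fst (g y), pullback_snd (g y)).
  by apply/funext => y; exact: surjective_pairing.
by move=> x; apply: cvg_pair; [exact: c1|exact: c2].
Qed.

Fact pullback_add_continuous :
  continuous (fun x : pullback * pullback => x.1 + x.2).
Proof.
apply: continuous_to_pullback.
  apply: (@continuous_addf _ _ (fun u => pullback_fst u.1)
                               (fun u => pullback_fst u.2)) => u.
    apply: (@continuous_comp _ _ _ fst pullback_fst); first exact: cvg_fst.
    exact: pullback_fst_continuous.
  apply: (@continuous_comp _ _ _ snd pullback_fst); first exact: cvg_snd.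
  exact: pullback_fst_continuous.
apply: (@continuous_addf _ _ (fun u => pullback_snd u.1)
                             (fun u => pullback_snd u.2)) => u.
  apply: (@continuous_comp _ _ _ fst pullback_snd); first exact: cvg_fst.
  exact: pullback_snd_continuous.
apply: (@continuous_comp _ _ _ snd pullback_snd); first exact: cvg_snd.
exact: pullback_snd_continuous.
Qed.

Fact pullback_opp_continuous : continuous (-%R : pullback -> pullback).
Proof.
apply: continuous_to_pullback.
  exact: (continuous_oppf pullback_fst_continuous).
exact: (continuous_oppf pullback_snd_continuous).
Qed.

HB.instance Definition _ :=
  PreTopologicalNmodule_isTopologicalNmodule.Build pullback
    pullback_add_continuous.
HB.instance Definition _ :=
  TopologicalNmodule_isTopologicalZmodule.Build pullback
    pullback_opp_continuous.

End Pullback.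

Arguments pullback_fst {X Z G p f}.
Arguments pullback_snd {X Z G p f}.

Lemma twisted_sum_proj_nbhs (Y X Z : topologicalZmodType)
    (i : {additive Y -> X}) (p : {additive X -> Z}) (x : X) (A : set X) :
  twisted_sum i p -> nbhs x A -> nbhs (p x) (p @` A).
Proof.
move=> ip; rewrite nbhsE => -[U [oU Ux] UA].
have [V oV pU] := twisted_sum_proj_open ip oU.
rewrite (twisted_sum_surj ip) setIT in pU.
apply: (@filterS _ _ _ (p @` U)); first exact: image_subset.
by apply: open_nbhs_nbhs; split; [rewrite pU|exists x].
Qed.

Section PullbackTwistedSum.
Variables (Y X Z G : topologicalZmodType).
Variables (i : {additive Y -> X}) (p : {additive X -> Z}).
Variables (f : {additive G -> Z}).
Hypothesis ip : twisted_sum i p.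

Lemma twisted_sum_comp0 y : p (i y) = 0.
Proof.
have : range i (i y) by exists y.
by rewrite (twisted_sum_exact ip).
Qed.

Fact pullback_in_subproof y : (i y, 0 : G) \in pullback_pred p f.
Proof. by rewrite inE /= twisted_sum_comp0 raddf0. Qed.

Definition pullback_in (y : Y) : pullback p f :=
  Pullback (pullback_in_subproof y).

Fact pullback_in_zmod_morphism : zmod_morphism pullback_in.
Proof.
move=> y z; apply: val_inj; apply: injective_projections => /=.
  by rewrite raddfB.
by rewrite subr0.
Qed.

HB.instance Definition _ := GRing.isZmodMorphism.Build Y (pullback p f)
  pullback_in pullback_in_zmod_morphism.

(** Exactness and openness of the inclusion are inherited from i because the
    image of Y lies over 0. The projection to G is open because a neighbourhood
    A x B of (x, g) in the pullback projects onto f^-1(p(A)) `&` B, and p(A) is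
    a neighbourhood of p x = f g. *)
Lemma pullback_twisted_sum :
  continuous f -> twisted_sum pullback_in (@pullback_snd _ _ _ p f).
Proof.
move=> cf; split.
- by move=> y z /(congr1 pullback_fst); exact: (twisted_sum_inj ip).
- apply/seteqP; split=> [_ [y _ <-] //|u /= u2].
  have : range i (pullback_fst u).
    by rewrite (twisted_sum_exact ip) /= pullbackP u2 raddf0.
  move=> [y _ yu]; exists y => //; apply: val_inj.
  exact: injective_projections.
- apply/seteqP; split=> // g _.
  have : range p (f g) by rewrite (twisted_sum_surj ip).
  move=> [x _ pxg]; have xg : (x, g) \in pullback_pred p f.
    by rewrite inE /= pxg.
  by exists (Pullback xg).
- apply: continuous_to_pullback => [|y]; last exact: cvg_cst.
  exact: (twisted_sum_inj_continuous ip).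
- exact: pullback_snd_continuous.
- move=> U oU; have [V oV iU] := twisted_sum_inj_open ip oU.
  exists (pullback_fst @^-1` V).
    by apply: open_comp oV => u _; exact: pullback_fst_continuous.
  apply/seteqP; split=> [_ [y Uy <-]|u [/= Vu [y _ yu]]].
    split; last by exists y.
    have : (i @` U) (i y) by exists y.
    by rewrite iU => -[].
  move: Vu; rewrite -{}yu => Viy.
  have : (i @` U) (i y) by rewrite iU; split=> //; exists y.
  by move=> [y' Uy' /(twisted_sum_inj ip) yy']; exists y => //; rewrite -yy'.
- move=> U oU; exists (pullback_snd @` U); last first.
    apply/seteqP; split=> [_ [u Uu <-]|g []//].
    by split; [exists u|exists u].
  rewrite openE => _ [u Uu <-].
  have [W oW WU] := oU.
  have : nbhs (val u) W by apply: open_nbhs_nbhs; split=> //; rewrite -WU in Uu.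
  move=> [[A B] [/= uA uB] ABW].
  have pA := twisted_sum_proj_nbhs ip uA.
  rewrite pullbackP in pA.
  have fA : nbhs (pullback_snd u) (f @^-1` (p @` A)) by exact: cf.
  apply: (filterS _ (filterI fA uB)) => g [/= [x Ax pxg] Bg].
  have xg : (x, g) \in pullback_pred p f by rewrite inE /= pxg.
  exists (Pullback xg) => //; rewrite -WU; exact: (ABW (x, g)).
Qed.

End PullbackTwistedSum.

(** * Splittings and continuous sections *)

Section Sections.
Variables (Y X Z : topologicalZmodType).
Variables (i : {additive Y -> X}) (p : {additive X -> Z}).
Hypothesis ip : twisted_sum i p.

(** The map q := x - i (Phi x).1 is constant on the fibres of p, because
    Phi (i y) = (y, 0) makes it vanish on the image of i. So it factors through
    p; as p is open and onto, the factorisation s is continuous. *)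
Lemma splits_section : splits i p ->
  exists s : {additive Z -> X}, continuous s /\ cancel s p.
Proof.
move=> [Phi [cPhi Phii _]].
pose q (x : X) : X := x - i (Phi x).1.
have qB : zmod_morphism q.
  move=> x y; rewrite /q raddfB /= raddfB opprB opprD opprK.
  by rewrite [in RHS]addrACA; congr (_ + _); rewrite addrC.
have pq x : p (q x) = p x by rewrite /q raddfB (twisted_sum_comp0 ip) subr0.
have q_fiber x y : p x = p y -> q x = q y.
  move=> pxy; apply/eqP; rewrite -subr_eq0 -qB; apply/eqP.
  have : range i (x - y).
    by rewrite (twisted_sum_exact ip) /= raddfB pxy subrr.
  by move=> [z _ <-]; rewrite /q Phii subrr.
have cq : continuous q.
  apply: (@continuous_idB _ (fun x => i (Phi x).1)) => x.
  apply: (@continuous_comp _ _ _ (fun y => (Phi y).1) i); last first.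
    exact: (twisted_sum_inj_continuous ip).
  apply: (@continuous_comp _ (Y * Z)%type _ Phi fst); first exact: cPhi.
  exact: cvg_fst.
have /choice[l pl] : forall z, exists x, p x = z.
  move=> z; have : range p z by rewrite (twisted_sum_surj ip).
  by move=> [x _ <-]; exists x.
pose s := q \o l.
have sB : zmod_morphism s.
  by move=> y z; rewrite /s /= -qB; apply: q_fiber; rewrite raddfB !pl.
pose sA : {additive Z -> X} :=
  HB.pack s (GRing.isZmodMorphism.Build _ _ s sB).
exists sA; split=> /= [|z].
  apply/continuousP => U oU.
  have /(twisted_sum_proj_open ip)[V oV] : open (q @^-1` U).
    by apply: open_comp oU => x _; exact: cq.
  rewrite (twisted_sum_surj ip) setIT => qU.
  rewrite [X in open X](_ : _ = V)// -qU.
  apply/seteqP; split=> [z Us|z [x Ux pxz]].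
    by exists (l z).
  by rewrite /s /= (q_fiber _ x)// pl.
by rewrite /s /= pq pl.
Qed.

(** As p (x - s (p x)) = 0, exactness provides r with i (r x) = x - s (p x);
    the splitting is x |-> (r x, p x). *)
Lemma section_splits (s : {additive Z -> X}) :
  continuous s -> cancel s p -> splits i p.
Proof.
move=> cs sK.
have /choice[r ir] : forall x, exists y, i y = x - s (p x).
  move=> x; have : range i (x - s (p x)).
    by rewrite (twisted_sum_exact ip) /= raddfB sK subrr.
  by move=> [y _ <-]; exists y.
have cr : continuous r.
  apply/continuousP => U oU; have [V oV iU] := twisted_sum_inj_open ip oU.
  rewrite [X in open X](_ : _ = (fun x => x - s (p x)) @^-1` V).
    apply: open_comp oV => x _; move: x.
    apply: (@continuous_idB _ (s \o p)) => x.
    apply: continuous_comp; last exact: cs.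
    exact: (twisted_sum_proj_continuous ip).
  apply/seteqP; split=> x /=; rewrite -ir => Hx.
    by have : (i @` U) (i (r x)) by [exists (r x)]; rewrite iU => -[].
  have : (i @` U) (i (r x)) by rewrite iU; split=> //; exists (r x).
  by move=> [y Uy /(twisted_sum_inj ip) <-].
pose Phi x := (r x, p x).
have PhiB : zmod_morphism Phi.
  move=> x y; apply: injective_projections => /=; last by rewrite raddfB.
  apply: (twisted_sum_inj ip); rewrite raddfB !ir raddfB /= raddfB.
  by rewrite opprB opprD opprK [in RHS]addrACA; congr (_ + _); rewrite addrC.
pose PhiA : {additive X -> Y * Z} :=
  HB.pack Phi (GRing.isZmodMorphism.Build _ _ Phi PhiB).
exists PhiA; split=> /= [|y|//].
  move=> x; apply: cvg_pair; first exact: cr.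
  exact: (twisted_sum_proj_continuous ip).
rewrite /Phi (twisted_sum_comp0 ip); congr (_, _).
by apply: (twisted_sum_inj ip); rewrite ir (twisted_sum_comp0 ip) raddf0 subr0.
Qed.

End Sections.

(** A section of the pullback of p along f, followed by the projection to X, is
    a lift of f through p. *)
Lemma STG_lift (Y X Z G : topologicalZmodType)
    (i : {additive Y -> X}) (p : {additive X -> Z}) (f : {additive G -> Z}) :
  STG Y G -> twisted_sum i p -> continuous f ->
  exists h : {additive G -> X}, continuous h /\ forall g, p (h g) = f g.
Proof.
move=> SG ip cf; have tw := pullback_twisted_sum ip cf.
have [s [cs sK]] := splits_section tw (SG _ _ _ tw).
exists (pullback_fst \o s)%FUN; split=> [x|g] /=.
  by apply: continuous_comp; [exact: cs|exact: pullback_fst_continuous].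
by rewrite pullbackP sK.
Qed.

(** * Universal property of the coproduct *)

Section UniversalProperty.
Variables (I : Type) (G : I -> topologicalZmodType).

Lemma coproductBE (f g : coproduct G) a : (f - g) a = f a - g a.
Proof. by []. Qed.

Lemma coproduct_sumE (J : Type) (r : seq J) (F : J -> coproduct G) b :
  (\sum_(j <- r) F j) b = \sum_(j <- r) F j b.
Proof. by apply: (big_morph (fun f : coproduct G => f b)). Qed.

Lemma coproduct_inE b (x : G b) : coproduct_in x b = x.
Proof. exact: (@dfwithin {classic I}). Qed.

Lemma coproduct_in_out b a (x : G b) :
  b <> a -> (coproduct_in x : coproduct G) a = 0.
Proof.
by move=> ba; rewrite /= (@dfwithout {classic I})//; apply/eqP.
Qed.

Fact coproduct_in_zmod_morphism b : zmod_morphism (@coproduct_in I G b).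
Proof.
move=> x y; apply: dirsumP => a.
have [<-|ba] := pselect (b = a).
  by rewrite coproductBE !coproduct_inE.
by rewrite coproductBE !coproduct_in_out// subr0.
Qed.

HB.instance Definition _ b := GRing.isZmodMorphism.Build (G b) (coproduct G)
  (@coproduct_in I G b) (@coproduct_in_zmod_morphism b).


Section Glue.
Variables (X : zmodType) (h : forall a, {additive G a -> X}).

Definition coproduct_glue (f : coproduct G) : X :=
  \sum_(a \in [set: {classic I}]) h a (f a).

(** Replacing the support of f by a larger finite set allows comparing the sums
    attached to elements with different supports. *)
Lemma coproduct_glueE (D : set {classic I}) (f : coproduct G) :
  [set a | f a <> 0] `<=` D ->
  coproduct_glue f = \sum_(a \in D) h a (f a).
Proof.
move=> fD; apply/esym/fsbig_widen => // a [_ Da] /=.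
have [->|/fD//] := pselect (f a = 0).
by rewrite raddf0.
Qed.

Fact coproduct_glue_zmod_morphism : zmod_morphism coproduct_glue.
Proof.
move=> f g.
pose D : set {classic I} := [set a | f a <> 0] `|` [set a | g a <> 0].
have finD : finite_set D.
  by rewrite finite_setU; split; exact: dirsum_finite.
rewrite !(@coproduct_glueE D); last 3 first.
- by move=> a ga; right.
- by move=> a fa; left.
- move=> a /= fga; have [fa|] := pselect (f a = 0); last by left.
  by right => ga; apply: fga; rewrite fa ga subr0.
by rewrite !fsbig_finite// -sumrB; apply: eq_bigr => a _; rewrite -raddfB.
Qed.

HB.instance Definition _ := GRing.isZmodMorphism.Build (coproduct G) X
  coproduct_glue coproduct_glue_zmod_morphism.

Lemma coproduct_glue_in b (x : G b) : coproduct_glue (coproduct_in x) = h b x.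
Proof.
rewrite (@coproduct_glueE [set b]) ?fsbig_set1 ?coproduct_inE//.
move=> a; apply: contra_notP => ab.
by apply: coproduct_in_out => ba; apply: ab.
Qed.

End Glue.

(** Every element is the finite sum of the images of its coordinates. *)
Lemma coproduct_additive_eq (X : zmodType) (u v : {additive coproduct G -> X}) :
  (forall b (x : G b), u (coproduct_in x) = v (coproduct_in x)) -> u =1 v.
Proof.
move=> uv f.
pose D : set {classic I} := [set a | f a <> 0].
have finD : finite_set D by exact: dirsum_finite.
have -> : f = \sum_(a \in D) (coproduct_in (f a) : coproduct G).
  apply: dirsumP => b; rewrite fsbig_finite// coproduct_sumE -fsbig_finite//.
  pose F (a : {classic I}) : G b := (coproduct_in (f a) : coproduct G) b.
  have Fb : F b = f b by exact: coproduct_inE.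
  have F0 a : a <> b -> F a = 0 by exact: coproduct_in_out.
  (* Both sides are the sum of F over all indices: F vanishes away from b, and
     at b too when b is outside the support D. *)
  transitivity (\sum_(a \in [set b : {classic I}]) F a).
    by rewrite fsbig_set1 Fb.
  rewrite (@fsbig_widen {classic I} _ _ _ [set b] setT)//; last first.
    by move=> a [_ /F0].
  apply/esym/fsbig_widen => // a [_ Da]; have [ab|/F0//] := pselect (a = b).
  suff : F a = 0 by [].
  by rewrite ab Fb; apply: contra_notP Da => fb; rewrite ab.
by rewrite !fsbig_finite// !raddf_sum; apply: eq_bigr => a _; exact: uv.
Qed.

End UniversalProperty.

(** The topology induced by the glued map is admissible, so its open sets are
    open in the finest admissible topology. *)
Lemma coproduct_glue_continuous (I : Type) (G : I -> topologicalZmodType)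
    (X : topologicalZmodType) (h : forall a, {additive G a -> X}) :
  (forall a, continuous (h a)) -> continuous (coproduct_glue h).
Proof.
move=> ch.
pose T := initial_topology (coproduct_glue h).
have adm : admissible (Topological.class T).
  split.
  - exact: (@initial_add_continuous (coproduct G) X (coproduct_glue h)).
  - exact: (@initial_opp_continuous (coproduct G) X (coproduct_glue h)).
  - move=> b; apply: (@continuous_comp_initial _ _ _ (coproduct_glue h)).
    have -> : coproduct_glue h \o @coproduct_in I G b = h b.
      by apply/funext => x; exact: coproduct_glue_in.
    exact: ch.
apply/continuousP => U oU; apply: (coproduct_open adm).
by exists U.
Qed.

(** * Stability under coproducts *)

Lemma STG_coproduct (Y : topologicalZmodType) (I : Type)
    (G : I -> topologicalZmodType) :
  (forall a, STG Y (G a)) -> STG Y (coproduct G).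
Proof.
move=> SG X i p ip.
have /(_ _)/cid lift a : exists h : {additive G a -> X},
    continuous h /\ forall x, p (h x) = coproduct_in x.
  exact: (STG_lift (SG a) ip (@coproduct_in_continuous I G a)).
pose h a := projT1 (lift a).
apply: (@section_splits _ _ _ i p ip (coproduct_glue h)).
  by apply: coproduct_glue_continuous => a; case: (projT2 (lift a)).
apply: (@coproduct_additive_eq I G _ (p \o coproduct_glue h)%FUN idfun).
move=> b x /=.
by rewrite coproduct_glue_in; case: (projT2 (lift b)).
Qed.

Unset Implicit Arguments.

Theorem proposition2p21 (R : realType) (I : Type)
    (G : I -> topologicalZmodType) :
  (forall a : I, STG (circle R) (G a)) -> STG (circle R) (coproduct G).
Proof. exact: STG_coproduct. Qed.
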